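(* Let $Q$ be a left quasigroup. The following are equivalent: (i) $Q$ is superconnected. (ii) $\mathrm{Sg}(a,b)$ is connected for every $a,b\in Q$.
   Context: A left quasigroup is an algebra $(Q,*,\backslash)$ satisfying $x\backslash(x*y)=y=x*(x\backslash y)$; equivalently every left multiplication $L_a:b\mapsto a*b$ is a bijection of $Q$. $\mathrm{LMlt}(Q)=\langle L_a:a\in Q\rangle$ is the left multiplication group. $Q$ is connected if $\mathrm{LMlt}(Q)$ is transitive on $Q$, and superconnected if every subalgebra (subset closed under $*$ and $\backslash$) is connected with respect to its own left multiplication group. $\mathrm{Sg}(a,b)$ is the smallest subalgebra of $Q$ containing $a$ and $b$. *)

(* Defs.v *)
From mathcomp Require Import all_boot.
From mathcomp Require Import boolp classical_sets.

Set Implicit Arguments.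
Unset Strict Implicit.
Unset Printing Implicit Defensive.

Local Open Scope classical_set_scope.

Declare Scope lqg_scope.
Delimit Scope lqg_scope with lqg.

Record leftQuasigroup := LeftQuasigroup {
  lqg_sort :> Type;
  lqg_mul : lqg_sort -> lqg_sort -> lqg_sort;
  lqg_ldiv : lqg_sort -> lqg_sort -> lqg_sort;
  lqg_mulK : forall x y, lqg_ldiv x (lqg_mul x y) = y;
  lqg_ldivK : forall x y, lqg_mul x (lqg_ldiv x y) = y
}.

Notation "x * y" := (lqg_mul x y) : lqg_scope.
Notation "x \ y" := (lqg_ldiv x y) (at level 40, left associativity) : lqg_scope.

Local Open Scope lqg_scope.

(* Subgroups of Sym(T), as sets of self-maps of T. The inverse of f is
   any two-sided inverse g. *)
Definition perm_group (T : Type) (G : set (T -> T)) : Prop :=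
  [/\ G `<=` [set f | bijective f],
      G id,
      forall f g, G f -> G g -> G (f \o g)
    & forall f g, G f -> cancel f g -> cancel g f -> G g].

Definition perm_gen (T : Type) (A : set (T -> T)) : set (T -> T) :=
  smallest (@perm_group T) A.

Definition perm_transitive (T : Type) (G : set (T -> T)) : Prop :=
  forall x y : T, exists2 f, G f & f x = y.

Definition left_mult (Q : leftQuasigroup) (a : Q) : Q -> Q := fun b => a * b.

Definition LMlt (Q : leftQuasigroup) : set (Q -> Q) :=
  perm_gen (range (@left_mult Q)).

Definition connected (Q : leftQuasigroup) : Prop := perm_transitive (@LMlt Q).

Definition subalgebra (Q : leftQuasigroup) (S : set Q) : Prop :=
  (forall x y, S x -> S y -> S (x * y)) /\
  (forall x y, S x -> S y -> S (x \ y)).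

Section SubLeftQuasigroup.
Variables (Q : leftQuasigroup) (S : set Q) (subS : subalgebra S).

Definition sub_mul (x y : S) : S :=
  exist _ (val x * val y)
    (mem_set (subS.1 _ _ (set_mem (valP x)) (set_mem (valP y)))).

Definition sub_ldiv (x y : S) : S :=
  exist _ (val x \ val y)
    (mem_set (subS.2 _ _ (set_mem (valP x)) (set_mem (valP y)))).

Lemma sub_mulK (x y : S) : sub_ldiv x (sub_mul x y) = y.
Proof. by apply: val_inj; rewrite /= lqg_mulK. Qed.

Lemma sub_ldivK (x y : S) : sub_mul x (sub_ldiv x y) = y.
Proof. by apply: val_inj; rewrite /= lqg_ldivK. Qed.

Definition sub_lqg : leftQuasigroup := LeftQuasigroup sub_mulK sub_ldivK.

End SubLeftQuasigroup.

Definition superconnected (Q : leftQuasigroup) : Prop :=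
  forall (S : set Q) (subS : subalgebra S), connected (sub_lqg subS).

Definition Sg (Q : leftQuasigroup) (A : set Q) : set Q :=
  smallest (@subalgebra Q) A.

Lemma Sg_subalgebra (Q : leftQuasigroup) (A : set Q) : subalgebra (Sg A).
Proof.
split=> x y Sx Sy B [subB AB].
- by apply: subB.1; [apply: Sx | apply: Sy].
- by apply: subB.2; [apply: Sx | apply: Sy].
Qed.

(* Generation really yields a subgroup of Sym(Q); since every left
   multiplication is a bijection, the family intersected is nonempty. *)
Lemma left_mult_bij (Q : leftQuasigroup) (a : Q) : bijective (left_mult a).
Proof.
by exists (lqg_ldiv a) => b; rewrite /left_mult (lqg_mulK, lqg_ldivK).
Qed.

Lemma LMlt_perm_group (Q : leftQuasigroup) : perm_group (@LMlt Q).
Proof.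
split=> [f Lf||f g Lf Lg G GP|f g Lf fK gK G GP].
- apply: Lf; split=> [|_ [a _ <-]]; last exact: left_mult_bij.
  split=> //=; first by exists id.
  + by move=> h k; apply: bij_comp.
  + by move=> h k _ hK kK; exists h.
- by move=> G [[]].
- by have [_ _ GM _] := GP.1; apply: GM; [apply: Lf | apply: Lg].
- by have [_ _ _ GV] := GP.1; apply: GV fK gK; apply: Lf.
Qed.

(* Main.v *)
Require Import Defs.
From mathcomp Require Import all_boot.
From mathcomp Require Import boolp classical_sets.
Local Open Scope classical_set_scope.

(** Only the passage from two-generated subalgebras to an arbitrary subalgebra
    [S] has content. A permutation in [LMlt] of a subalgebra [T] of [S] can
    extend to [LMlt S] in several ways, so instead of transporting permutations
    one transports orbits: being in the same [LMlt S]
    orbit is an equivalence relation on [S] under which each [b] is related to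
    each [a * b] ([same_orbit_left_mult]). Its restriction to [T] keeps these
    properties, and such a relation on a connected left quasigroup is total
    ([connected_total]). Taking for [T] the subalgebra generated by two points
    [x], [y] of [S] puts [x] and [y] in one [LMlt S] orbit. *)

Local Open Scope lqg_scope.

Definition same_orbit (Q : leftQuasigroup) (x y : Q) : Prop :=
  exists2 f, @LMlt Q f & f x = y.

Lemma same_orbit_refl (Q : leftQuasigroup) (x : Q) : same_orbit Q x x.
Proof. by exists id => //; have [] := LMlt_perm_group Q. Qed.

Lemma same_orbit_sym (Q : leftQuasigroup) (x y : Q) :
  same_orbit Q x y -> same_orbit Q y x.
Proof.
have [bijL _ _ invL] := LMlt_perm_group Q.
move=> [f Lf <-]; have [g fK gK] := bijL _ Lf.
by exists g; [exact: invL fK gK | exact: fK].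
Qed.

Lemma same_orbit_trans (Q : leftQuasigroup) (x y z : Q) :
  same_orbit Q x y -> same_orbit Q y z -> same_orbit Q x z.
Proof.
have [_ _ compL _] := LMlt_perm_group Q.
by move=> [f Lf <-] [g Lg <-]; exists (g \o f) => //; apply: compL.
Qed.

Lemma same_orbit_left_mult (Q : leftQuasigroup) (a b : Q) :
  same_orbit Q b (a * b).
Proof.
by exists (left_mult a) => // G [_]; apply; exists a.
Qed.

(** The bijections that move every point within its [E]-class form a group;
    it contains the left multiplications, hence all of [LMlt Q], and the latter
    is transitive. *)
Lemma connected_total (Q : leftQuasigroup) (E : Q -> Q -> Prop) :
  (forall x, E x x) -> (forall x y, E x y -> E y x) ->
  (forall x y z, E x y -> E y z -> E x z) ->
  (forall a b, E b (a * b)) ->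
  connected Q -> forall x y, E x y.
Proof.
move=> Erefl Esym Etrans Emul conQ x y; have [f Lf <-] := conQ x y.
suff [_] : [set h | bijective h /\ forall u, E u (h u)] f by apply.
apply: Lf; split; last first.
  by move=> _ [a _ <-]; split=> [|u]; [exact: left_mult_bij | exact: Emul].
split=> [h [] //||h k [hbij hE] [kbij kE]|h k [_ hE] hK kK].
- by split=> //; exists id.
- by split=> [|u]; [exact: bij_comp | exact: Etrans (kE u) (hE (k u))].
- split=> [|u]; first by exists h.
  by apply: Esym; rewrite -{2}[u]kK.
Qed.

(** Inclusion of subalgebras, as a map into the larger one, preserves products;
    this lets the orbit relation of [S] be pulled back to [T]. *)
Lemma same_orbit_sub (Q : leftQuasigroup) (S T : set Q)
    (subS : subalgebra S) (subT : subalgebra T) (TS : T `<=` S) :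
  connected (sub_lqg subT) ->
  forall x y : S, T (val x) -> T (val y) -> same_orbit (sub_lqg subS) x y.
Proof.
move=> conT x y Tx Ty.
pose incl (u : T) : S := exist _ (val u) (mem_set (TS _ (set_mem (valP u)))).
have inclE (z : S) (Tz : T (val z)) : incl (exist _ (val z) (mem_set Tz)) = z.
  exact: val_inj.
rewrite -(inclE x Tx) -(inclE y Ty).
move: (exist _ _ _) (exist _ _ _) => u v.
apply: (connected_total (sub_lqg subT)
  (fun u v => same_orbit (sub_lqg subS) (incl u) (incl v))) => //.
- by move=> w; exact: same_orbit_refl.
- by move=> w z; exact: same_orbit_sym.
- by move=> w z t; exact: same_orbit_trans.
- move=> a b.
  have -> : incl (a * b) = ((incl a : sub_lqg subS) * incl b) by apply: val_inj.
  exact: same_orbit_left_mult.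
Qed.

Local Close Scope lqg_scope.

Theorem lemma1p4 (Q : leftQuasigroup) :
  superconnected Q <->
  (forall a b : Q, connected (sub_lqg (Sg_subalgebra [set a; b]))).
Proof.
split=> [supQ a b|con2 S subS x y]; first exact: supQ.
apply: (same_orbit_sub Q S (Sg [set val x; val y])) (con2 _ _) _ _ _ _.
- apply: smallest_sub => // _ [->|->]; exact: set_mem (valP _).
- by apply: sub_gen_smallest; left.
- by apply: sub_gen_smallest; right.
Qed.
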